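(* Let $a\in\mathbb{C}$ with $|a|<1$ and let $1\le p<\infty$. For every $f\in L^p(\mathbb{T})$ and every $n=0,1,2,\dots$, $$\|S_n^a(f)\|_p\le\left(\frac{1+|a|}{1-|a|}\right)^{2/p}\Lambda_n\,\|f\|_p .$$
   Context: $\mathbb{T}=\mathbb{R}/2\pi\mathbb{Z}$; functions on $\mathbb{T}$ are real- or complex-valued and identified with $2\pi$-periodic functions on $\mathbb{R}$; $\|f\|_p=\left(\frac1{2\pi}\int_{\mathbb{T}}|f(x)|^p\,dx\right)^{1/p}$. For $a=|a|e^{it_a}$, $|a|<1$, the nonlinear phase function $\theta_a:\mathbb{R}\to\mathbb{R}$ is the continuous function with $e^{i\theta_a(t)}=\dfrac{e^{it}-a}{1-\overline{a}e^{it}}$ (a fixed choice of continuous branch). It is strictly increasing, satisfies $\theta_a(t+2\pi)=\theta_a(t)+2\pi$, and has derivative the Poisson kernel $\theta_a'(t)=p_a(t)=\dfrac{1-|a|^2}{1-2|a|\cos(t-t_a)+|a|^2}$. For $f\in L^1(\mathbb{T})$, $c_k(f)=\dfrac1{2\pi}\displaystyle\int_{-\pi}^{\pi}f(t)e^{-ik\theta_a(t)}p_a(t)\,dt$ for $k\in\mathbb{Z}$, and $S_n^a(f)(x)=\displaystyle\sum_{k=-n}^{n}c_k(f)e^{ik\theta_a(x)}$. $\Lambda_n=\dfrac1{2\pi}\displaystyle\int_{-\pi}^{\pi}|D_n(t)|\,dt$ is the Lebesgue constant, where $D_n(t)=\sum_{k=-n}^{n}e^{ikt}$ is the Dirichlet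 kernel. *)

(* Defs.v *)
(* MathComp-Analysis, with R[i] from mathcomp-real-closed for the complex numbers. *)
From HB Require Import structures.
From mathcomp Require Import all_boot all_order all_algebra.
From mathcomp Require Import all_classical all_reals all_analysis.
From mathcomp Require Import complex.

Set Implicit Arguments.
Unset Strict Implicit.
Unset Printing Implicit Defensive.

Import Order.TTheory GRing.Theory Num.Theory.
Import numFieldNormedType.Exports.

Local Open Scope classical_set_scope.
Local Open Scope ring_scope.
Local Open Scope complex_scope.

(* Real-valued modulus; the library's `|z| on R[i] takes its values in R[i]. *)
Definition cmod (R : realType) (z : R[i]) : R := Normc.normc z.

Definition expi (R : realType) (t : R) : R[i] := cos t +i* sin t.

Definition symsum (R : realType) (n : nat) (F : int -> R[i]) : R[i] :=
  \sum_(j < n.*2.+1) F (j%:Z - n%:Z).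

Definition measurable_cfun (R : realType) (f : R -> R[i]) : Prop :=
  measurable_fun [set: R] (fun x => complex.Re (f x)) /\
  measurable_fun [set: R] (fun x => complex.Im (f x)).

(* Meaningful for integrable g: Rintegral is a total operator. *)
Definition cmean (R : realType) (g : R -> R[i]) : R[i] :=
  ((2 * pi)^-1 * \int[lebesgue_measure]_(x in `[- pi, pi]) complex.Re (g x)) +i*
  ((2 * pi)^-1 * \int[lebesgue_measure]_(x in `[- pi, pi]) complex.Im (g x)).

Definition LpNorm (R : realType) (p : R) (f : R -> R[i]) : \bar R :=
  ((((2 * pi)^-1)%R%:E *
    \int[lebesgue_measure]_(x in `[(- pi)%R, pi]) (cmod (f x) `^ p)%R%:E)
   `^ (p^-1)%R)%E.

(* Functions on the circle are 2 pi-periodic functions on the line; elements of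
   L^p are represented by functions rather than by classes modulo a.e. equality;
   measurability is Borel measurability, and every class has such a representative. *)
Definition in_Lp (R : realType) (p : R) (f : R -> R[i]) : Prop :=
  [/\ periodic f (2 * pi), measurable_cfun f & (LpNorm p f < +oo)%E].

Definition is_phase (R : realType) (a : R[i]) (theta : R -> R) : Prop :=
  continuous theta /\
  forall t, expi (theta t) = (expi t - a) / (1 - a^* * expi t).

(* The Poisson kernel p_a for a = r e^{i ta}. *)
Definition poisson (R : realType) (r ta t : R) : R :=
  (1 - r ^+ 2) / (1 - 2 * r * cos (t - ta) + r ^+ 2).

Definition coef (R : realType) (r ta : R) (theta : R -> R) (f : R -> R[i])
    (k : int) : R[i] :=
  cmean (fun t => f t * expi (- (k%:~R * theta t)) * (poisson r ta t)%:C).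

Definition partial_sum (R : realType) (r ta : R) (theta : R -> R) (n : nat)
    (f : R -> R[i]) (x : R) : R[i] :=
  symsum n (fun k => coef r ta theta f k * expi (k%:~R * theta x)).

Definition dirichlet (R : realType) (n : nat) (t : R) : R[i] :=
  symsum n (fun k => expi (k%:~R * t)).

Definition lebesgue_const (R : realType) (n : nat) : R :=
  (2 * pi)^-1 *
  \int[lebesgue_measure]_(t in `[- pi, pi]) cmod (@dirichlet R n t).

(* Main.v *)
Require Import Defs.
From HB Require Import structures.
From mathcomp Require Import all_boot all_order all_algebra.
From mathcomp Require Import all_classical all_reals all_analysis.
From mathcomp Require Import complex.
From mathcomp Require Import measurable_realfun ring lra.

(** The partial sum is an integral operator: summing under the integral,

      S f(x) = 1/(2 pi) int f(t) D_n(theta x - theta t) p_a(t) dt,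

    where D_n is the Dirichlet kernel and the Poisson kernel p_a is the
    derivative of the phase theta ([partial_sumE]).  The substitution
    u = theta t - c, a lift of a diffeomorphism of the circle, shows that

      1/(2 pi) int |D_n(theta t - c)| p_a(t) dt = Lambda_n   for every c

    ([integral_dirichlet_phase]).  As |D_n| is even, the kernel
    |D_n(theta x - theta t)| / (2 pi) has mass Lambda_n in x and in t with
    respect to the measure p_a(t) dt, and Schur's test ([schur_test], Hoelder
    followed by Tonelli) bounds the operator on L^p(p_a dt) by Lambda_n.
    Finally (1 - |a|)/(1 + |a|) <= p_a <= (1 + |a|)/(1 - |a|), so the p-th powers
    of the norms of L^p(p_a dt) and of L^p(dt) are comparable, with one factor
    (1 + |a|)/(1 - |a|) in each direction; after taking p-th roots this is the
    exponent 2/p ([integral_partial_sum_le]).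

    The phase enters only through e^{ik theta} with k an integer, hence only
    through e^{i theta}, so any branch may be replaced by an explicit one,
    [phase_branch], whose derivative and increment over a period can be computed
    directly. *)

Set Implicit Arguments.
Unset Strict Implicit.
Unset Printing Implicit Defensive.

Import Order.TTheory GRing.Theory Num.Theory.
Import numFieldNormedType.Exports.

Local Open Scope classical_set_scope.
Local Open Scope ring_scope.
Local Open Scope complex_scope.

(** * Points of the unit circle *)

Section unit_circle.
Context {R : realType}.
Implicit Types (s t r : R) (z w : R[i]) (k : int).

Lemma expiD s t : expi (s + t) = expi s * expi t.
Proof.
rewrite /expi cosD sinD; apply/eqP; rewrite eq_complex /=.
by apply/andP; split; apply/eqP; ring.
Qed.

Lemma expi0 : expi 0 = 1 :> R[i].
Proof. by rewrite /expi cos0 sin0. Qed.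

Lemma expiNr t : expi t * expi (- t) = 1.
Proof. by rewrite -expiD subrr expi0. Qed.

Lemma cmodM z w : cmod (z * w) = cmod z * cmod w.
Proof. exact: Normc.normcM. Qed.

Lemma cmod_ge0 z : 0 <= cmod z.
Proof. by case: z => x y; rewrite /cmod /= sqrtr_ge0. Qed.

Lemma cmod_real s : cmod s%:C = `|s|.
Proof. by rewrite /cmod /= expr0n addr0 sqrtr_sqr. Qed.

Lemma cmod_expi t : cmod (expi t) = 1.
Proof. by rewrite /cmod /= cos2Dsin2 sqrtr1. Qed.

Lemma ler_Re_cmod z : `|complex.Re z| <= cmod z.
Proof.
by case: z => x y; rewrite /cmod/= -sqrtr_sqr ler_wsqrtr// lerDl sqr_ge0.
Qed.

Lemma ler_Im_cmod z : `|complex.Im z| <= cmod z.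
Proof.
by case: z => x y; rewrite /cmod/= -sqrtr_sqr ler_wsqrtr// lerDr sqr_ge0.
Qed.

(** At integer frequencies only the point of the circle matters, not the
    argument chosen for it.  This is what makes the partial sums independent of
    the branch of the phase. *)
Lemma expi_intr_congr s t k : expi s = expi t -> expi (k%:~R * s) = expi (k%:~R * t).
Proof.
have expiX (u : R) (n : nat) : expi (n%:R * u) = expi u ^+ n.
  elim: n => [|n IHn]; first by rewrite mul0r expi0.
  by rewrite mulrS mulrDl mul1r expiD IHn exprS.
move=> st; case: k => n; first by rewrite -!pmulrn !expiX st.
rewrite NegzE !mulrNz !mulNr.
rewrite -[LHS]mulr1 -(expiNr (n.+1%:~R * t)) mulrA -!pmulrn !expiX -st.
by rewrite -expiX [X in X * _]mulrC expiNr mul1r.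
Qed.

Lemma expi_intr_periodic k t : expi (k%:~R * (t + 2 * pi)) = expi (k%:~R * t).
Proof.
apply: expi_intr_congr; rewrite expiD /expi mulr_natl.
by rewrite (cos2pi R) (sin2pi R) mulr1.
Qed.

End unit_circle.

(** * The phase function and the Poisson kernel *)

Section phase_branch.
Context {R : realType} (r ta : R).
Hypotheses (r0 : 0 <= r) (r1 : r < 1).
Implicit Types t : R.

(** The phase in closed form.  With s = t - ta, the quotient defining the phase
    is e^{it} times conj(z) / z for z = 1 - r e^{is}.  As z lies in the right
    half-plane, its argument is - atan (r sin s / (1 - r cos s)), so
    conj(z) / z has argument twice this arctangent. *)
Definition phase_branch t : R :=
  t + 2 * atan (r * sin (t - ta) / (1 - r * cos (t - ta))).

Let den_gt0 t : 0 < 1 - r * cos t.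
Proof.
by rewrite subr_gt0 (le_lt_trans _ r1)// ler_piMr// cos_le1.
Qed.

Let poisson_den t : (1 - r * cos (t - ta)) ^+ 2 + (r * sin (t - ta)) ^+ 2 =
  1 - 2 * r * cos (t - ta) + r ^+ 2.
Proof. by rewrite !exprMn sin2cos2; ring. Qed.

Lemma poisson_den_gt0 t : 0 < 1 - 2 * r * cos (t - ta) + r ^+ 2.
Proof. by rewrite -poisson_den ltr_pwDl ?sqr_ge0// exprn_gt0. Qed.

Lemma is_derive_phase_branch t : is_derive t (1 : R) phase_branch (poisson r ta t).
Proof.
have ne0 := lt0r_neq0 (den_gt0 (t - ta)).
have ne1 := lt0r_neq0 (poisson_den_gt0 t).
have ds : is_derive t (1 : R) (fun t => r * sin (t - ta)) (r * cos (t - ta)).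
  by apply: trigger_derive; rewrite /GRing.scale/=; ring.
have dd : is_derive t (1 : R) (fun t => (1 - r * cos (t - ta))) (r * sin (t - ta)).
  by apply: trigger_derive; rewrite /GRing.scale/=; ring.
have dq : is_derive t (1 : R) (fun t => r * sin (t - ta) / (1 - r * cos (t - ta)))
    ((r * cos (t - ta) - r ^+ 2) / (1 - r * cos (t - ta)) ^+ 2).
  have dV := @is_deriveV _ (fun t => 1 - r * cos (t - ta)) _ _ _ ne0 dd.
  apply: is_derive_eq (is_deriveM ds dV) _ => /=.
  rewrite /GRing.scale/=.
  transitivity ((r * cos (t - ta) * (1 - r * cos (t - ta)) - (r * sin (t - ta)) ^+ 2)
    / (1 - r * cos (t - ta)) ^+ 2); first by field.
  by congr (_ / _); rewrite exprMn sin2cos2; ring.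
have da := is_derive1_comp (is_derive1_atan _) dq.
have := is_deriveD (is_derive_id t (1:R)) (is_deriveZ 2 da).
move=> h; apply: is_derive_eq h _; rewrite /GRing.scale/=.
rewrite /poisson -!poisson_den in ne1 *.
transitivity (1 + 2 * (r * cos (t - ta) - r ^+ 2) /
    ((1 - r * cos (t - ta)) ^+ 2 + (r * sin (t - ta)) ^+ 2)).
  by field; rewrite ne0 ne1.
apply: (canRL (mulfK ne1)); rewrite mulrDl mulfVK// mul1r poisson_den.
by ring.
Qed.

Lemma expi_phase_branch (a : R[i]) t : a = r%:C * expi ta ->
  expi (phase_branch t) = (expi t - a) / (1 - a^* * expi t).
Proof.
move=> aE; set s := t - ta; set u := r * sin s; set v := 1 - r * cos s.
have v0 : 0 < v by exact: den_gt0.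
set y := atan (u / v).
have tE : expi t = expi ta * expi s by rewrite -expiD /s addrC subrK.
(* The two conjugations on R[i] are convertible but not syntactically equal. *)
have conjE (z : R[i]) : Num.conj z = conjc z by [].
have dE : 1 - a^* * expi t = v -i* u.
  rewrite aE tE conjE.
  have -> : conjc (r%:C * expi ta) = r%:C * expi (- ta).
    apply/eqP; rewrite eq_complex/= cosN sinN.
    by apply/andP; split; apply/eqP; ring.
  rewrite -mulrA [X in _ * X]mulrA [X in _ * (X * _)]mulrC expiNr mul1r.
  by apply/eqP; rewrite eq_complex/= /u /v; apply/andP; split; apply/eqP; ring.
have nE : expi t - a = expi t * (v +i* u).
  have -> : a = expi t * (r%:C * expi (- s)).
    by rewrite aE /s opprB mulrCA -expiD addrC subrK.
  rewrite -[X in X - _]mulr1 -mulrBr; congr (_ * _).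
  apply/eqP; rewrite eq_complex/= sinN cosN /u /v.
  by apply/andP; split; apply/eqP; ring.
have cy0 : 0 < cos y by apply: cos_gt0_pihalf; rewrite atan_gtNpi2 atan_ltpi2.
(* c is the inverse of the modulus of v + i u, since y is its argument. *)
pose c := cos y / v.
have c0 : c%:C != 0 by rewrite eq_complex /= eqxx andbT mulf_neq0 ?invr_eq0 ?gt_eqF.
have sy : sin y = u * c.
  have := atanK (u / v); rewrite -/y /tan => /(canRL (mulfVK (lt0r_neq0 cy0))) ->.
  by rewrite /c mulrAC mulrA.
have yE : expi y = c%:C * (v +i* u).
  apply/eqP; rewrite eq_complex/= /expi /= sy /c.
  by apply/andP; split; apply/eqP; field; rewrite gt_eqF.
have yNE : expi (- y) = c%:C * (v -i* u).
  apply/eqP; rewrite eq_complex/= /expi /= cosN sinN sy /c.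
  by apply/andP; split; apply/eqP; field; rewrite gt_eqF.
have vu0 : v -i* u != 0 by rewrite eq_complex/= gt_eqF.
rewrite nE dE; apply: (canRL (mulfK vu0)).
rewrite /phase_branch -/s -/u -/v -/y expiD -mulrA; congr (_ * _).
apply: (mulfI c0); rewrite mulrCA -yNE -yE -expiD.
by congr expi; ring.
Qed.

Lemma phase_branchD2pi t : phase_branch (t + 2 * pi) = phase_branch t + 2 * pi.
Proof.
rewrite /phase_branch [t + _ - _]addrAC mulr_natl.
by rewrite sinD2pi cosD2pi addrAC.
Qed.

Lemma poisson_gt0 t : 0 < poisson r ta t.
Proof. by rewrite /poisson divr_gt0 ?poisson_den_gt0// subr_gt0 expr_lt1. Qed.

Lemma poisson_le t : poisson r ta t <= (1 + r) / (1 - r).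
Proof.
rewrite /poisson ler_pdivrMr ?poisson_den_gt0// mulrAC ler_pdivlMr ?subr_gt0//.
rewrite -subr_ge0 [leRHS](_ : _ = 2 * r * (1 + r) * (1 - cos (t - ta)));
  last by ring.
by rewrite mulr_ge0// ?subr_ge0 ?cos_le1// mulr_ge0 ?addr_ge0// mulr_ge0.
Qed.

Lemma poisson_ge t : ((1 + r) / (1 - r))^-1 <= poisson r ta t.
Proof.
rewrite invf_div /poisson ler_pdivlMr ?poisson_den_gt0//.
rewrite mulrAC ler_pdivrMr ?ltr_wpDr//.
rewrite -subr_ge0 [leRHS](_ : _ = 2 * r * (1 - r) * (1 + cos (t - ta)));
  last by ring.
apply: mulr_ge0; last by have := cos_geN1 (t - ta); lra.
by rewrite mulr_ge0 ?subr_ge0 ?(ltW r1)// mulr_ge0.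
Qed.

Lemma continuous_phase_branch : continuous phase_branch.
Proof.
move=> t; apply: differentiable_continuous; apply/derivable1_diffP.
have := is_derive_phase_branch t.
by move=> h; exact: ex_derive.
Qed.

Lemma continuous_poisson : continuous (poisson r ta).
Proof.
move=> t; apply: differentiable_continuous; apply/derivable1_diffP.
have dd : is_derive t (1 : R) (fun t => 1 - 2 * r * cos (t - ta) + r ^+ 2)
    (2 * r * sin (t - ta)).
  by apply: trigger_derive; rewrite /GRing.scale/=; ring.
have ne0 := lt0r_neq0 (poisson_den_gt0 t).
apply: derivableM; first exact: derivable_cst.
by apply: derivableV => //; exact: ex_derive.
Qed.

End phase_branch.

(** * Integrals of periodic functions *)

Section periodic_integral.
Context {R : realType}.
Local Notation mu := (@lebesgue_measure R).
Implicit Types (g F w : R -> R) (a b c T : R).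

Lemma continuous_integrable_itv g a b : continuous g ->
  mu.-integrable `[a, b] (EFin \o g).
Proof.
move=> cg; apply: continuous_compact_integrable; first exact: segment_compact.
exact: continuous_subspaceT.
Qed.

Lemma integral_itv_change_of_variables g F w a b : a <= b ->
  continuous g -> continuous w -> (forall x, 0 < w x) ->
  (forall x, is_derive x (1 : R) F (w x)) ->
  (\int[mu]_(x in `[F a, F b]) (g x)%:E =
   \int[mu]_(x in `[a, b]) (g (F x) * w x)%:E)%E.
Proof.
move=> ab cg cw w0 dF.
have F'E : F^`()%classic = w by apply/funext => x; rewrite derive1E derive_val.
have cF : continuous F.
  move=> x; apply: differentiable_continuous; apply/derivable1_diffP.
  exact: ex_derive.
have homoF : {homo F : x y / x < y}.
  move=> x y xy; rewrite -subr_gt0.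
  have cFxy : {within `[x, y], continuous F} by exact: continuous_subspaceT.
  have [z _ ->] := MVT xy (fun z _ => dF z) cFxy.
  by rewrite mulr_gt0 ?subr_gt0.
have -> : (fun x => (g (F x) * w x)%:E) = fun x => (((g \o F) * F^`()%classic) x)%:E.
  by rewrite F'E.
apply: integration_by_substitution_increasing => //; rewrite ?F'E.
- by move=> x y _ _; exact: homoF.
- by move=> x _; exact: cw.
- by apply: cvgP; apply: cvg_at_right_filter; exact: cw.
- by apply: cvgP; apply: cvg_at_left_filter; exact: cw.
- split; first by move=> x _; exact: ex_derive.
    by apply: cvg_at_right_filter; exact: cF.
  by apply: cvg_at_left_filter; exact: cF.
- exact: continuous_subspaceT.
Qed.

(** For a <= b, compare both ways of cutting [a, b + T]: at a + T or at b.  The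
    pieces [a, b] and [a + T, b + T] are translates of each other by a period. *)
Lemma integral_periodic g T a b : 0 <= T -> continuous g -> periodic g T ->
  (\int[mu]_(x in `[a, (a + T)%R]) (g x)%:E =
   \int[mu]_(x in `[b, (b + T)%R]) (g x)%:E)%E.
Proof.
move=> T0 cg gT; wlog ab : a b / a <= b.
  by move=> H; have [/H//|/ltW/H ->] := leP a b.
have intg x y := @continuous_integrable_itv g x y cg.
have fin x y : (\int[mu]_(t in `[x, y]) (g t)%:E)%E \is a fin_num.
  by apply: integrable_fin_num => //; exact: intg.
rewrite -[LHS]fineK// -[RHS]fineK//; congr EFin.
have split_at x y z : x <= y -> y <= z ->
    \int[mu]_(t in `[x, z]) g t =
    \int[mu]_(t in `[x, y]) g t + \int[mu]_(t in `[y, z]) g t.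
  move=> xy yz; rewrite -[X in _ + X]Rintegral_itv_obnd_cbnd; last first.
    by apply: integrableS (intg y z) => //; exact: subset_itv_oc_cc.
  rewrite -(@Rintegral_itvB _ _ (BLeft x) (BRight z) y) ?bnd_simp//.
  by rewrite addrC subrK.
have shift : \int[mu]_(t in `[a + T, b + T]) g t = \int[mu]_(t in `[a, b]) g t.
  congr fine.
  have dT (x : R) : is_derive x (1 : R) (fun x => x + T) ((cst 1 : R -> R) x).
    by apply: trigger_derive; rewrite addr0.
  have c1 : continuous (cst 1 : R -> R) by exact: cst_continuous.
  rewrite (integral_itv_change_of_variables ab cg c1 (fun=> ltr01) dT).
  by apply: eq_integral => x _; rewrite mulr1 gT.
rewrite -!/(Rintegral _ _ _).
have := split_at a (a + T) (b + T); rewrite lerDl lerD2r => /(_ T0 ab).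
rewrite (split_at a b (b + T)) ?lerDl// shift => /eqP.
by rewrite addrC (inj_eq (addIr _)) => /eqP.
Qed.

(** F is the lift of an orientation-preserving diffeomorphism of the circle of
    length T, and w its derivative.  The interval F([a, a + T]) is one period
    long, but it starts at F a; periodicity of g moves it back to a. *)
Lemma integral_circle_change_of_variables g F w T a : 0 <= T ->
  continuous g -> periodic g T -> continuous w -> (forall x, 0 < w x) ->
  (forall x, is_derive x (1 : R) F (w x)) -> F (a + T) = F a + T ->
  (\int[mu]_(x in `[a, (a + T)%R]) (g (F x) * w x)%:E =
   \int[mu]_(x in `[a, (a + T)%R]) (g x)%:E)%E.
Proof.
move=> T0 cg gT cw w0 dF FT.
rewrite -integral_itv_change_of_variables ?lerDl// FT.
exact: integral_periodic.
Qed.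

End periodic_integral.

(** * Schur's test *)

Section schur_test.
Context d (T : measurableType d) (R : realType).
Implicit Types (F G W w : T -> R) (p L : R).
Local Open Scope ereal_scope.

(** Jensen's inequality for the convex function x^p and the measure W mu, not
    normalised.  It is Hoelder's inequality for the factorisation
    F W = (F W^{1/p}) (W^{1/q}), with q the conjugate exponent of p. *)
Lemma poweR_integral_le (mu : {measure set T -> \bar R}) F W p : (1 <= p)%R ->
  measurable_fun setT F -> measurable_fun setT W ->
  (forall t, 0 <= F t)%R -> (forall t, 0 <= W t)%R ->
  (\int[mu]_t (F t * W t)%:E) `^ p <=
  (\int[mu]_t (W t)%:E) `^ (p - 1) * \int[mu]_t (F t `^ p * W t)%:E.
Proof.
move=> p1 mF mW F0 W0; have p0 : (0 < p)%R by exact: lt_le_trans p1.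
have FW0 : 0 <= \int[mu]_t (F t * W t)%:E.
  by apply: integral_ge0 => t _; rewrite lee_fin mulr_ge0.
(* For p = 1 there is no finite conjugate exponent, but nothing to prove. *)
have [pE|pN1] := eqVneq p 1%R.
  rewrite pE subrr poweRe0 mul1e poweRe1//.
  by under [leRHS]eq_integral do rewrite powRr1//.
have p1' : (0 < p - 1)%R by rewrite subr_gt0 lt_neqAle eq_sym pN1.
pose q := (p / (p - 1))%R.
have q0 : (0 < q)%R by rewrite divr_gt0.
have pq : (p^-1 + q^-1 = 1)%R by rewrite /q; field; rewrite !gt_eqF.
pose f t := (F t * W t `^ p^-1)%R; pose g t := (W t `^ q^-1)%R.
have mpow e : measurable_fun setT (fun t => W t `^ e)%R.
  exact: (@measurableT_comp _ _ _ _ _ _ (@powR R ^~ e)).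
have mf : measurable_fun setT f by exact: measurable_funM.
have fg t : (f t * g t = F t * W t)%R.
  by rewrite /f /g -mulrA -powRD ?pq ?oner_eq0// powRr1.
have := hoelder mu mf (mpow q^-1%R) p0 q0 pq.
rewrite Lnorm1 [leLHS](_ : _ = \int[mu]_t (F t * W t)%:E); last first.
  by apply: eq_integral => t _; rewrite /= fg ger0_norm ?mulr_ge0.
move=> /(gt0_ler_poweR (ltW p0)); rewrite !in_itv/= !leey !andbT.
move=> /(_ FW0 (mule_ge0 (Lnorm_ge0 _ _ _) (Lnorm_ge0 _ _ _))) /le_trans; apply.
rewrite poweRM ?Lnorm_ge0// poweR_Lnorm ?gt_eqF// muleC lee_pmul ?poweR_ge0//.
- by apply: integral_ge0 => t _; exact: poweR_ge0.
- rewrite unlock -poweRrM (_ : q^-1 * p = p - 1)%R; last first.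
    by rewrite /q; field; rewrite !gt_eqF.
  rewrite [X in X `^ _ <= _](_ : _ = \int[mu]_t (W t)%:E)//.
  apply: eq_integral => t _; rewrite /= ger0_norm ?powR_ge0//.
  by rewrite -powRrM mulVf ?gt_eqF// powRr1.
- rewrite [leLHS](_ : _ = \int[mu]_t (F t `^ p * W t)%:E)//.
  apply: eq_integral => t _; rewrite /= ger0_norm ?mulr_ge0 ?powR_ge0//.
  by rewrite /f powRM ?powR_ge0// -powRrM mulVf ?gt_eqF// powRr1.
Qed.

(** Schur's test for a kernel K with respect to the measure w mu.  Jensen's
    inequality in t uses the bound on the rows of K and costs L^{p-1}; after
    exchanging the integrals, the bound on the columns costs one more factor L.
    The function G stands for any majorised image of F, so that the operator
    itself may be complex-valued. *)
Lemma schur_test (mu : {sigma_finite_measure set T -> \bar R})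
    (K : T * T -> R) F G w p L : (1 <= p)%R -> (0 <= L)%R ->
  measurable_fun setT K -> measurable_fun setT F -> measurable_fun setT G ->
  measurable_fun setT w ->
  (forall z, 0 <= K z)%R -> (forall t, 0 <= F t)%R -> (forall t, 0 <= G t)%R ->
  (forall t, 0 <= w t)%R ->
  (forall x, \int[mu]_t (K (x, t) * w t)%:E <= L%:E) ->
  (forall t, \int[mu]_x (K (x, t) * w x)%:E <= L%:E) ->
  (forall x, (G x)%:E <= \int[mu]_t (F t * (K (x, t) * w t))%:E) ->
  \int[mu]_x (G x `^ p * w x)%:E <=
  (L `^ p)%:E * \int[mu]_t (F t `^ p * w t)%:E.
Proof.
move=> p1 L0 mK mF mG mw K0 F0 G0 w0 rowL colL GF.
have p0 : (0 < p)%R by exact: lt_le_trans p1.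
have mKx x : measurable_fun setT (fun t => K (x, t)).
  exact: measurable_fun_pair2.
have mKt t : measurable_fun setT (fun x => K (x, t)).
  exact: measurable_fun_pair1.
have mFp : measurable_fun setT (fun t => F t `^ p)%R.
  exact: (@measurableT_comp _ _ _ _ _ _ (@powR R ^~ p)).
pose H (z : T * T) := (F z.2 `^ p * (K z * w z.2) * w z.1)%:E.
have H0 z : 0 <= H z by rewrite lee_fin !mulr_ge0// powR_ge0.
have mH : measurable_fun setT H.
  apply/measurable_EFinP; apply: measurable_funM; last first.
    exact: measurableT_comp mw measurable_fst.
  apply: measurable_funM; first exact: measurableT_comp mFp measurable_snd.
  by apply: measurable_funM => //; exact: measurableT_comp mw measurable_snd.
have LpE : (L `^ p = L `^ (p - 1) * L)%R by rewrite mulrC mulr_powRB1.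
have mHx : measurable_fun setT (fun x => \int[mu]_t H (x, t)).
  exact: (measurable_fun_fubini_tonelli_F H mH H0).
have mHt : measurable_fun setT (fun t => \int[mu]_x H (x, t)).
  exact: (measurable_fun_fubini_tonelli_G H mH H0).
apply: (@le_trans _ _ (\int[mu]_x ((L `^ (p - 1))%:E * \int[mu]_t H (x, t)))).
  apply: ge0_le_integral => //.
  - by move=> x _; rewrite lee_fin mulr_ge0 ?powR_ge0.
  - apply/measurable_EFinP; apply: measurable_funM => //.
    exact: (@measurableT_comp _ _ _ _ _ _ (@powR R ^~ p)).
  - by apply: emeasurable_funM => //; exact: measurable_cst.
  - move=> x _; have Kw0 t : (0 <= K (x, t) * w t)%R by rewrite mulr_ge0.
    have mKw : measurable_fun setT (fun t => K (x, t) * w t)%R.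
      exact: measurable_funM.
    rewrite [X in _ <= _ * X](_ : _ =
        (\int[mu]_t (F t `^ p * (K (x, t) * w t))%:E) * (w x)%:E); last first.
      rewrite -ge0_integralZr//.
      + by apply/measurable_EFinP; exact: measurable_funM.
      + by move=> t _; rewrite lee_fin mulr_ge0 ?powR_ge0.
      + by rewrite lee_fin.
    rewrite EFinM muleA lee_wpmul2r ?lee_fin//.
    have FK0 : 0 <= \int[mu]_t (F t * (K (x, t) * w t))%:E.
      by apply: integral_ge0 => t _; rewrite lee_fin mulr_ge0.
    apply: (@le_trans _ _ ((\int[mu]_t (F t * (K (x, t) * w t))%:E) `^ p)).
      rewrite -poweR_EFin gt0_ler_poweR ?(ltW p0)// in_itv/= leey ?lee_fin.
        by rewrite G0.
      by rewrite FK0.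
    apply: le_trans (poweR_integral_le mu p1 mF mKw F0 Kw0) _.
    apply: lee_wpmul2r.
      by apply: integral_ge0 => t _; rewrite lee_fin mulr_ge0 ?powR_ge0.
    rewrite -poweR_EFin gt0_ler_poweR ?subr_ge0//.
      rewrite in_itv/= leey andbT; apply: integral_ge0 => t _.
      by rewrite lee_fin.
    by rewrite in_itv/= leey andbT lee_fin.
rewrite ge0_integralZl//; last 2 first.
- by move=> x _; exact: integral_ge0.
- by rewrite lee_fin powR_ge0.
rewrite LpE EFinM -muleA lee_wpmul2l ?lee_fin ?powR_ge0//.
rewrite (@fubini_tonelli _ _ _ _ _ mu mu H mH H0) -ge0_integralZl//; last 2 first.
- by apply/measurable_EFinP; exact: measurable_funM.
- by move=> t _; rewrite lee_fin mulr_ge0 ?powR_ge0.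
apply: ge0_le_integral => //.
- by move=> t _; exact: integral_ge0.
- apply: emeasurable_funM; first exact: measurable_cst.
  by apply/measurable_EFinP; exact: measurable_funM.
- move=> t _; have Fw0 : (0 <= F t `^ p * w t)%R by rewrite mulr_ge0 ?powR_ge0.
  rewrite [leLHS](_ : _ = \int[mu]_x ((F t `^ p * w t)%:E * (K (x, t) * w x)%:E)).
    rewrite ge0_integralZl//; last 2 first.
    + by apply/measurable_EFinP; exact: measurable_funM.
    + by move=> x _; rewrite lee_fin mulr_ge0.
    by rewrite muleC lee_wpmul2r ?lee_fin.
  by apply: eq_integral => x _; rewrite /H/= -EFinM; congr EFin; ring.
Qed.

End schur_test.

(** * Integrable complex functions and their means *)

Section complex_functions.
Context {R : realType}.
Local Notation mu := (@lebesgue_measure R).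
Local Notation D := (`[- pi, pi]%classic : set R).
Implicit Types (f g h : R -> R[i]) (c : R[i]) (C : R).

Lemma cmodE (z : R[i]) : cmod z = Num.sqrt (complex.Re z ^+ 2 + complex.Im z ^+ 2).
Proof. by case: z. Qed.

Lemma ReM (z w : R[i]) : complex.Re (z * w) =
  complex.Re z * complex.Re w - complex.Im z * complex.Im w.
Proof. by case: z w => [? ?] [? ?]. Qed.

Lemma ImM (z w : R[i]) : complex.Im (z * w) =
  complex.Re z * complex.Im w + complex.Im z * complex.Re w.
Proof. by case: z w => [? ?] [? ?]. Qed.

Lemma Re_sum I (s : seq I) (F : I -> R[i]) :
  complex.Re (\sum_(i <- s) F i) = \sum_(i <- s) complex.Re (F i).
Proof. by apply: (big_morph (@complex.Re R)) => // -[? ?] [? ?]. Qed.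

Lemma Im_sum I (s : seq I) (F : I -> R[i]) :
  complex.Im (\sum_(i <- s) F i) = \sum_(i <- s) complex.Im (F i).
Proof. by apply: (big_morph (@complex.Im R)) => // -[? ?] [? ?]. Qed.

Lemma measurable_cfun_cst c : measurable_cfun (cst c).
Proof. by split; exact: measurable_cst. Qed.

Lemma measurable_cfunM f g : measurable_cfun f -> measurable_cfun g ->
  measurable_cfun (fun t => f t * g t).
Proof.
move=> [mRf mIf] [mRg mIg]; split.
  by under eq_fun do rewrite ReM; apply: measurable_funB; exact: measurable_funM.
by under eq_fun do rewrite ImM; apply: measurable_funD; exact: measurable_funM.
Qed.

Lemma measurable_cfun_sum I (s : seq I) (F : I -> R -> R[i]) :
  (forall i, measurable_cfun (F i)) ->
  measurable_cfun (fun t => \sum_(i <- s) F i t).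
Proof.
move=> mF; split.
  by under eq_fun do rewrite Re_sum; apply: measurable_sum => i; have [] := mF i.
by under eq_fun do rewrite Im_sum; apply: measurable_sum => i; have [] := mF i.
Qed.

Lemma measurable_cfun_real (u : R -> R) : measurable_fun setT u ->
  measurable_cfun (fun t => (u t)%:C).
Proof. by move=> mu_; split => //; exact: measurable_cst. Qed.

Lemma measurable_cfun_expi (u : R -> R) : measurable_fun setT u ->
  measurable_cfun (fun t => expi (u t)).
Proof.
move=> mu_; split; apply: measurableT_comp mu_; apply: continuous_measurable_fun.
  exact: continuous_cos.
exact: continuous_sin.
Qed.

Lemma measurable_cmod f : measurable_cfun f ->
  measurable_fun setT (fun t => cmod (f t)).
Proof.
move=> [mRf mIf]; under eq_fun do rewrite cmodE.
apply: (@measurableT_comp _ _ _ _ _ _ (@Num.sqrt R)).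
  by apply: continuous_measurable_fun; exact: sqrt_continuous.
by apply: measurable_funD; exact: measurable_funX.
Qed.

(** Integrability over one period is imposed on the modulus, because every
    integrand below is obtained from f by a bounded factor; the real and
    imaginary parts follow by domination. *)
Definition cintegrable f :=
  measurable_cfun f /\ mu.-integrable D (fun t => (cmod (f t))%:E).

Lemma cintegrable_le f g C : cintegrable f -> measurable_cfun g ->
  (forall t, cmod (g t) <= C * cmod (f t)) -> cintegrable g.
Proof.
move=> [_ intf] mg gf; split => //.
apply: le_integrable (integrableZl _ C intf) => //.
  by apply/measurable_EFinP; apply: measurable_funTS; exact: measurable_cmod.
move=> t _; rewrite /= lee_fin ger0_norm ?cmod_ge0//.
by rewrite (le_trans (gf t))// ler_norm.
Qed.

Lemma cintegrableM_bounded f g C : cintegrable f -> measurable_cfun g ->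
  (forall t, cmod (g t) <= C) -> cintegrable (fun t => f t * g t).
Proof.
move=> intf mg gC; apply: (@cintegrable_le f _ C) => //.
  by apply: measurable_cfunM => //; case: intf.
by move=> t; rewrite cmodM mulrC ler_wpM2r ?cmod_ge0.
Qed.

Lemma cintegrable_Re f : cintegrable f ->
  mu.-integrable D (fun t => (complex.Re (f t))%:E).
Proof.
move=> [[mRf mIf] intf]; apply: le_integrable intf => //.
  by apply/measurable_EFinP; exact: measurable_funTS.
move=> t _; rewrite /= lee_fin [leRHS]ger0_norm ?cmod_ge0//.
exact: ler_Re_cmod.
Qed.

Lemma cintegrable_Im f : cintegrable f ->
  mu.-integrable D (fun t => (complex.Im (f t))%:E).
Proof.
move=> [[mRf mIf] intf]; apply: le_integrable intf => //.
  by apply/measurable_EFinP; exact: measurable_funTS.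
move=> t _; rewrite /= lee_fin [leRHS]ger0_norm ?cmod_ge0//.
exact: ler_Im_cmod.
Qed.

Lemma cintegrableD f g : cintegrable f -> cintegrable g ->
  cintegrable (fun t => f t + g t).
Proof.
move=> intf intg; have [[mRf mIf] _] := intf; have [[mRg mIg] _] := intg.
have mfg : measurable_cfun (fun t => f t + g t).
  split.
    rewrite (_ : (fun t => _) = fun t => complex.Re (f t) + complex.Re (g t)).
      exact: measurable_funD.
    by apply/funext => t; case: (f t) (g t) => [? ?] [? ?].
  rewrite (_ : (fun t => _) = fun t => complex.Im (f t) + complex.Im (g t)).
    exact: measurable_funD.
  by apply/funext => t; case: (f t) (g t) => [? ?] [? ?].
split => //; apply: le_integrable (integrableD _ intf.2 intg.2) => //.
  by apply/measurable_EFinP; apply: measurable_funTS; exact: measurable_cmod.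
move=> t _; rewrite /= lee_fin !ger0_norm ?addr_ge0 ?cmod_ge0//.
exact: le_normcD.
Qed.

Lemma cmeanD f g : cintegrable f -> cintegrable g ->
  cmean (fun t => f t + g t) = cmean f + cmean g.
Proof.
move=> intf intg; apply/eqP; rewrite eq_complex/= -!mulrDr.
rewrite -RintegralD//; [|exact: cintegrable_Re..].
rewrite -RintegralD//; [|exact: cintegrable_Im..].
apply/andP; split; apply/eqP; congr (_ * _); apply: eq_Rintegral => t _.
  by case: (f t) (g t) => [? ?] [? ?].
by case: (f t) (g t) => [? ?] [? ?].
Qed.

Lemma cmeanMr f c : cintegrable f -> cmean (fun t => f t * c) = cmean f * c.
Proof.
move=> intf; have iR := cintegrable_Re intf; have iI := cintegrable_Im intf.
have iZ (u : R -> R) x : mu.-integrable D (EFin \o u) ->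
    mu.-integrable D (EFin \o (fun t => u t * x)).
  by move=> iu; apply: (integrableZr _ x iu).
apply/eqP; rewrite eq_complex/=; apply/andP; split; apply/eqP.
  rewrite ReM/= -!mulrA -mulrBr -!RintegralZr// -RintegralB; [|by []|exact: iZ..].
  by congr (_ * _); apply: eq_Rintegral => t _; rewrite ReM.
rewrite ImM/= -!mulrA -mulrDr -!RintegralZr// -RintegralD; [|by []|exact: iZ..].
by congr (_ * _); apply: eq_Rintegral => t _; rewrite ImM.
Qed.

Lemma cintegrable_sum I (s : seq I) (F : I -> R -> R[i]) :
  (forall i, cintegrable (F i)) -> cintegrable (fun t => \sum_(i <- s) F i t).
Proof.
move=> intF; elim: s => [|i s IHs].
  under eq_fun do rewrite big_nil.
  split; first exact: measurable_cfun_cst.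
  have -> : (fun t : R => (cmod (0 : R[i]))%:E) = cst 0%E.
    by apply/funext => t; rewrite [cmod _]Normc.normc0.
  exact: integrable0.
have -> : (fun t => \sum_(j <- i :: s) F j t) =
    fun t => F i t + \sum_(j <- s) F j t.
  by apply/funext => t; rewrite big_cons.
exact: cintegrableD.
Qed.

Lemma cmean_sum I (s : seq I) (F : I -> R -> R[i]) :
  (forall i, cintegrable (F i)) ->
  cmean (fun t => \sum_(i <- s) F i t) = \sum_(i <- s) cmean (F i).
Proof.
move=> intF; elim: s => [|i s IHs].
  rewrite big_nil; under eq_fun do rewrite big_nil.
  by rewrite /cmean /= Rintegral_cst// mul0r mulr0.
have -> : (fun t => \sum_(j <- i :: s) F j t) =
    fun t => F i t + \sum_(j <- s) F j t.
  by apply/funext => t; rewrite big_cons.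
by rewrite big_cons cmeanD// ?IHs//; exact: cintegrable_sum.
Qed.

(** With z the mean of f, integrating Re (f conj(z)) <= |f| |z| gives
    |z|^2 <= |z| times the mean of |f|. *)
Lemma cmod_cmean_le f : cintegrable f ->
  ((cmod (cmean f))%:E <=
   ((2 * pi)^-1)%:E * \int[mu]_(t in D) (cmod (f t))%:E)%E.
Proof.
move=> intf; set z := cmean f.
have [->|z0] := eqVneq (cmod z) 0.
  rewrite mule_ge0 ?lee_fin ?invr_ge0 ?mulr_ge0 ?pi_ge0// integral_ge0// => t _.
  by rewrite lee_fin cmod_ge0.
have intfz : cintegrable (fun t => f t * conjc z).
  exact: (cintegrableM_bounded (C := cmod (conjc z))).
have cmodJ : cmod (conjc z) = cmod z.
  by rewrite !cmodE; case: (z) => x y /=; rewrite sqrrN.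
have zz : complex.Re (z * conjc z) = cmod z ^+ 2.
  by rewrite cmodE sqr_sqrtr ?addr_ge0 ?sqr_ge0//; case: (z) => x y /=; ring.
have zf : (\int[mu]_(t in D) (complex.Re (f t * conjc z))%:E)%E =
    (2 * pi * cmod z ^+ 2)%:E.
  rewrite -zz -(cmeanMr _ intf) /= mulVKf ?mulf_neq0 ?gt_eqF ?pi_gt0//.
  rewrite fineK//; apply: integrable_fin_num => //; exact: cintegrable_Re.
have : ((2 * pi * cmod z ^+ 2)%:E <=
    (cmod z)%:E * \int[mu]_(t in D) (cmod (f t))%:E)%E.
  rewrite -zf -ge0_integralZl//; last 3 first.
  - apply/measurable_EFinP; apply: measurable_funTS; apply: measurable_cmod.
    by case: intf.
  - by move=> t _; rewrite lee_fin cmod_ge0.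
  - by rewrite lee_fin cmod_ge0.
  apply: le_integral => //.
  - exact: cintegrable_Re.
  - by apply: integrableZl => //; case: intf.
  - move=> t _; rewrite lee_fin (le_trans (ler_norm _))//.
    by rewrite (le_trans (ler_Re_cmod _))// cmodM cmodJ mulrC.
have zgt0 : 0 < cmod z by rewrite lt0r z0 cmod_ge0.
have intE : (\int[mu]_(t in D) (cmod (f t))%:E)%E \is a fin_num.
  by apply: integrable_fin_num => //; case: intf.
rewrite -(fineK intE) -!EFinM !lee_fin ler_pdivlMl ?mulr_gt0 ?pi_gt0//.
by rewrite expr2 [leLHS]mulrA [leLHS]mulrC ler_pM2l.
Qed.

End complex_functions.

(** * The Dirichlet kernel *)

Section dirichlet_kernel.
Context {R : realType}.
Local Notation mu := (@lebesgue_measure R).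
Local Notation D := (`[- pi, pi]%classic : set R).
Implicit Types (n : nat) (r ta t x : R) (theta : R -> R) (f : R -> R[i]).

Definition dirichlet_modulus n t : R := cmod (dirichlet n t).

Lemma Re_dirichlet n t : complex.Re (dirichlet n t) =
  \sum_(j < n.*2.+1) cos ((j%:Z - n%:Z)%:~R * t).
Proof. by rewrite /dirichlet /symsum Re_sum. Qed.

Lemma Im_dirichlet n t : complex.Im (dirichlet n t) =
  \sum_(j < n.*2.+1) sin ((j%:Z - n%:Z)%:~R * t).
Proof. by rewrite /dirichlet /symsum Im_sum. Qed.

Lemma continuous_dirichlet_modulus n : continuous (dirichlet_modulus n : R -> R).
Proof.
have cl (k : R) : continuous (fun t : R => k * t).
  by move=> t; apply: cvgM; [exact: cvg_cst|exact: cvg_id].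
have cR : continuous (fun t : R => complex.Re (dirichlet n t)).
  rewrite (_ : (fun _ => _) =
      fun t => \sum_(j < n.*2.+1) cos ((j%:Z - n%:Z)%:~R * t)).
    apply: continuous_big => [|j _ t]; first exact: add_continuous.
    by apply: (continuous_comp (cl _ _)); exact: continuous_cos.
  by apply/funext => t; exact: Re_dirichlet.
have cI : continuous (fun t : R => complex.Im (dirichlet n t)).
  rewrite (_ : (fun _ => _) =
      fun t => \sum_(j < n.*2.+1) sin ((j%:Z - n%:Z)%:~R * t)).
    apply: continuous_big => [|j _ t]; first exact: add_continuous.
    by apply: (continuous_comp (cl _ _)); exact: continuous_sin.
  by apply/funext => t; exact: Im_dirichlet.
rewrite (_ : dirichlet_modulus n = fun t =>
    Num.sqrt (complex.Re (dirichlet n t) ^+ 2 + complex.Im (dirichlet n t) ^+ 2)).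
  move=> t; apply: (@continuous_comp _ _ _
    (fun t => complex.Re (dirichlet n t) ^+ 2 + complex.Im (dirichlet n t) ^+ 2)
    (@Num.sqrt R)); last exact: sqrt_continuous.
  by apply: cvgD; rewrite expr2; apply: cvgM; (exact: cR || exact: cI).
by apply/funext => t; rewrite /dirichlet_modulus cmodE.
Qed.

Lemma dirichlet_modulus_periodic n : periodic (dirichlet_modulus n) (2 * pi : R).
Proof.
move=> t; rewrite /dirichlet_modulus /dirichlet /symsum; congr cmod.
by apply: eq_bigr => j _; exact: expi_intr_periodic.
Qed.

Lemma dirichlet_modulusN n t : dirichlet_modulus n (- t) = dirichlet_modulus n t.
Proof.
rewrite /dirichlet_modulus !cmodE !Re_dirichlet !Im_dirichlet.
under eq_bigr do rewrite mulrN cosN.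
under [in X in _ + X ^+ 2]eq_bigr do rewrite mulrN sinN.
by rewrite sumrN sqrrN.
Qed.

Lemma dirichlet_modulus_le n t : dirichlet_modulus n t <= n.*2.+1%:R.
Proof.
rewrite /dirichlet_modulus /dirichlet /symsum.
have -> : n.*2.+1%:R = \sum_(j < n.*2.+1) (1 : R) by rewrite sumr_const card_ord.
elim/big_ind2: _ => [|x u y v xu yv|j _]; first by rewrite [cmod _]Normc.normc0.
  by rewrite (le_trans (le_normcD _ _))// lerD.
by rewrite cmod_expi.
Qed.

Lemma integral_dirichlet_modulus n :
  (\int[mu]_(t in D) (dirichlet_modulus n t)%:E =
   (2 * pi * lebesgue_const R n)%:E)%E.
Proof.
rewrite /lebesgue_const mulVKf ?mulf_neq0 ?gt_eqF ?pi_gt0//.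
rewrite fineK//; apply: integrable_fin_num => //.
exact/continuous_integrable_itv/continuous_dirichlet_modulus.
Qed.

Lemma lebesgue_const_ge0 n : 0 <= lebesgue_const R n.
Proof.
rewrite mulr_ge0 ?invr_ge0 ?mulr_ge0 ?pi_ge0//.
by apply: Rintegral_ge0 => t _; exact: cmod_ge0.
Qed.

(** Summing the coefficients under the integral exhibits the partial sum as an
    integral operator, whose kernel is the Dirichlet kernel read in the phase
    coordinate. *)
Lemma partial_sumE r ta theta n f x : measurable_fun setT theta ->
  cintegrable (fun t => f t * (poisson r ta t)%:C) ->
  partial_sum r ta theta n f x =
  cmean (fun t => f t * (poisson r ta t)%:C * dirichlet n (theta x - theta t)).
Proof.
move=> mtheta intfw; set fw := (fun t => f t * _) in intfw.
have mk (k : int) : measurable_fun setT (fun t => - (k%:~R * theta t)).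
  by apply: measurable_funN; exact: measurable_funM.
have int1 (k : int) : cintegrable (fun t => fw t * expi (- (k%:~R * theta t))).
  apply: (cintegrableM_bounded (C := 1)) => //; first exact: measurable_cfun_expi.
  by move=> t; rewrite cmod_expi.
have int2 (k : int) : cintegrable
    (fun t => fw t * expi (- (k%:~R * theta t)) * expi (k%:~R * theta x)).
  apply: (cintegrableM_bounded (C := 1)) => //.
  by move=> t; rewrite cmod_expi.
transitivity (cmean (fun t => symsum n (fun k =>
    fw t * expi (- (k%:~R * theta t)) * expi (k%:~R * theta x)))).
  rewrite /partial_sum /symsum.
  rewrite (@cmean_sum _ _ _ (fun j t => _))//.
  apply: eq_bigr => j _; rewrite cmeanMr//; congr (cmean _ * _).
  by apply/funext => t; rewrite /fw mulrAC.
congr cmean; apply/funext => t; rewrite /symsum /dirichlet mulr_sumr.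
apply: eq_bigr => j _; rewrite -mulrA -expiD; congr (_ * expi _).
by rewrite mulrBr addrC.
Qed.

End dirichlet_kernel.

(** * The bound in the mean of order p *)

Section lp_bound.
Context {R : realType}.
Local Notation mu := (@lebesgue_measure R).
Local Notation D := (`[- pi, pi]%classic : set R).

Lemma integral_weight_restrict (h w : R -> R) :
  (\int[mu]_t (h t * (w \_ D) t)%:E = \int[mu]_(t in D) (h t * w t)%:E)%E.
Proof.
rewrite [RHS]integral_mkcond; apply: eq_integral => t _.
by rewrite !patchE; case: ifP => // _; rewrite mulr0.
Qed.

(** On a set of finite measure |f| <= 1 + |f|^p suffices. *)
Lemma LpNorm_lty_cintegrable (p : R) (f : R -> R[i]) : 1 <= p ->
  measurable_cfun f -> (LpNorm p f < +oo)%E -> cintegrable f.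
Proof.
move=> p1 mf; rewrite /LpNorm => Nf; have p0 : 0 < p by exact: lt_le_trans p1.
split => //.
have mFp : measurable_fun setT (fun t => cmod (f t) `^ p).
  apply: (@measurableT_comp _ _ _ _ _ _ (@powR R ^~ p)) => //.
  exact: measurable_cmod.
have intFp : mu.-integrable D (fun t => (cmod (f t) `^ p)%:E).
  apply/integrableP; split.
    by apply/measurable_EFinP; exact: measurable_funTS.
  under eq_integral => t _ do rewrite gee0_abs ?lee_fin ?powR_ge0//.
  have := lty_poweRy (invr_neq0 (lt0r_neq0 p0)) Nf.
  have [//|] := ltP (\int[mu]_(x in D) (cmod (f x) `^ p)%:E)%E +oo%E.
  rewrite leye_eq => /eqP ->; rewrite gt0_muley// lte_fin invr_gt0.
  by rewrite mulr_gt0 ?pi_gt0.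
have int1 : mu.-integrable D (cst 1%E).
  by apply: continuous_integrable_itv => t; exact: cvg_cst.
apply: le_integrable (integrableD _ int1 intFp) => //.
  by apply/measurable_EFinP; apply: measurable_funTS; exact: measurable_cmod.
move=> t _; rewrite /= lee_fin !ger0_norm ?addr_ge0 ?powR_ge0 ?cmod_ge0//.
have [c1|c1] := leP 1 (cmod (f t)).
  by rewrite (le_trans (le1r_powR c1 p1))// lerDr.
by rewrite (le_trans (ltW c1))// lerDl powR_ge0.
Qed.

Variables (r ta : R).
Hypotheses (r0 : 0 <= r) (r1 : r < 1).

Local Notation theta := (phase_branch r ta).
Local Notation w := (poisson r ta).
Local Notation M := ((1 + r) / (1 - r)).

Let M_gt0 : 0 < M.
Proof. by rewrite divr_gt0 ?subr_gt0// ltr_pwDl. Qed.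

Let measurable_theta : measurable_fun setT theta.
Proof.
apply: continuous_measurable_fun; exact: (continuous_phase_branch r0 r1).
Qed.

Let measurable_w : measurable_fun setT w.
Proof. by apply: continuous_measurable_fun; exact: (continuous_poisson r0 r1). Qed.

(** The substitution u = theta t - c, whose Jacobian is the Poisson kernel.  The
    value does not depend on c, which gives both bounds of Schur's test. *)
Lemma integral_dirichlet_phase n c :
  (\int[mu]_(t in D) (dirichlet_modulus n (theta t - c) * w t)%:E =
   (2 * pi * lebesgue_const R n)%:E)%E.
Proof.
rewrite -integral_dirichlet_modulus.
have DE : D = `[- pi, - pi + 2 * pi]%classic by rewrite mulr_natl mulr2n addKr.
rewrite DE.
apply: (@integral_circle_change_of_variables _ _ (fun t => theta t - c)).
- by rewrite mulr_ge0 ?pi_ge0.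
- exact: continuous_dirichlet_modulus.
- exact: dirichlet_modulus_periodic.
- exact: (continuous_poisson r0 r1).
- exact: poisson_gt0.
- move=> t; have := is_derive_phase_branch ta r0 r1 t => dt.
  by apply: is_derive_eq; rewrite subr0.
- by rewrite phase_branchD2pi addrAC.
Qed.

Lemma cmod_partial_sum_le n (f : R -> R[i]) x : cintegrable f ->
  ((cmod (partial_sum r ta theta n f x))%:E <=
   \int[mu]_(t in D) (cmod (f t) *
     ((2 * pi)^-1 * dirichlet_modulus n (theta x - theta t) * w t))%:E)%E.
Proof.
move=> intf; have mw := measurable_cfun_real measurable_w.
have intfw : cintegrable (fun t => f t * (w t)%:C).
  apply: (cintegrableM_bounded (C := M)) => // t.
  by rewrite cmod_real gtr0_norm ?poisson_gt0// poisson_le.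
rewrite partial_sumE//.
have mD : measurable_cfun (fun t => dirichlet n (theta x - theta t)).
  rewrite /dirichlet /symsum; apply: measurable_cfun_sum => j.
  apply: measurable_cfun_expi; apply: measurable_funM => //.
  exact: measurable_funB.
have intg := cintegrableM_bounded intfw mD (fun t => dirichlet_modulus_le n _).
apply: le_trans (cmod_cmean_le intg) _.
rewrite -ge0_integralZl//; last 3 first.
- apply/measurable_EFinP; apply: measurable_funTS; apply: measurable_cmod.
  by case: intg.
- by move=> t _; rewrite lee_fin cmod_ge0.
- by rewrite lee_fin invr_ge0 mulr_ge0 ?pi_ge0.
rewrite le_eqVlt; apply/orP; left; apply/eqP; apply: eq_integral => t _.
rewrite -EFinM !cmodM cmod_real gtr0_norm ?poisson_gt0//; congr EFin.
by rewrite /dirichlet_modulus; ring.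
Qed.

(** Schur's test gives the constant L^p for the measure with density the Poisson
    kernel.  Since 1/M <= poisson <= M, passing from the Lebesgue measure to
    this one and back costs a factor M each time. *)
Lemma integral_partial_sum_le n p (f : R -> R[i]) : 1 <= p -> cintegrable f ->
  (\int[mu]_(x in D) (cmod (partial_sum r ta theta n f x) `^ p)%:E <=
   (M ^+ 2 * lebesgue_const R n `^ p)%:E *
   \int[mu]_(t in D) (cmod (f t) `^ p)%:E)%E.
Proof.
move=> p1 intf; have [mf _] := intf.
set S := fun x => cmod (partial_sum r ta theta n f x).
set L := lebesgue_const R n.
have twopi : 0 < 2 * pi :> R by rewrite mulr_gt0 ?pi_gt0.
(* The poisson factor is left out of K: it is the density of the measure. *)
pose K (z : R * R) := (2 * pi)^-1 * dirichlet_modulus n (theta z.1 - theta z.2).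
have mS : measurable_fun setT S.
  apply: measurable_cmod; rewrite /partial_sum /symsum.
  apply: measurable_cfun_sum => j; apply: measurable_cfunM.
    exact: measurable_cfun_cst.
  by apply: measurable_cfun_expi; exact: measurable_funM.
have mpow (u : R -> R) : measurable_fun setT u ->
    measurable_fun setT (fun t => u t `^ p).
  exact: (@measurableT_comp _ _ _ _ _ _ (@powR R ^~ p)).
have wD_ge0 t : 0 <= (w \_ D) t.
  by rewrite patchE; case: ifP => // _; rewrite ltW ?poisson_gt0.
have mF : measurable_fun setT (fun t => cmod (f t)) by exact: measurable_cmod.
have mwD : measurable_fun setT (w \_ D).
  by apply/(measurable_restrictT _ _).1 => //; exact: measurable_funTS.
have mK : measurable_fun setT K.
  apply: measurable_funM => //.
  apply: (@measurableT_comp _ _ _ _ _ _ (dirichlet_modulus n)).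
    by apply: continuous_measurable_fun; exact: continuous_dirichlet_modulus.
  apply: measurable_funB.
    exact: measurableT_comp measurable_theta measurable_fst.
  exact: measurableT_comp measurable_theta measurable_snd.
have massK c : (\int[mu]_(t in D)
    ((2 * pi)^-1 * dirichlet_modulus n (theta t - c) * w t)%:E = L%:E)%E.
  under eq_integral => t _ do rewrite -mulrA EFinM.
  rewrite ge0_integralZl//; last 3 first.
  - apply/measurable_EFinP; apply: measurable_funTS; apply: measurable_funM => //.
    apply: (@measurableT_comp _ _ _ _ _ _ (dirichlet_modulus n)).
      by apply: continuous_measurable_fun; exact: continuous_dirichlet_modulus.
    exact: measurable_funB.
  - by move=> t _; rewrite lee_fin mulr_ge0 ?cmod_ge0 ?ltW ?poisson_gt0.
  - by rewrite lee_fin invr_ge0 ltW.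
  by rewrite integral_dirichlet_phase -EFinM mulVKf ?gt_eqF.
(* The weight is cut off outside one period, so that Schur's test applies on
   the whole line. *)
have schur : (\int[mu]_(x in D) (S x `^ p * w x)%:E <=
    (L `^ p)%:E * \int[mu]_(t in D) (cmod (f t) `^ p * w t)%:E)%E.
  rewrite -!integral_weight_restrict.
  apply: (@schur_test _ _ _ mu K (fun t => cmod (f t)) S (w \_ D)) => //.
  - exact: lebesgue_const_ge0.
  - by move=> z; rewrite mulr_ge0 ?cmod_ge0 ?invr_ge0 ?ltW.
  - by move=> t; exact: cmod_ge0.
  - by move=> t; exact: cmod_ge0.
  - move=> x; rewrite integral_weight_restrict -(massK (theta x)).
    rewrite le_eqVlt; apply/orP; left; apply/eqP; apply: eq_integral => t _.
    by rewrite /K /= -(opprB (theta t)) dirichlet_modulusN.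
  - by move=> t; rewrite integral_weight_restrict -(massK (theta t)) lexx.
  - move=> x; under eq_integral => t _ do rewrite mulrA.
    rewrite integral_weight_restrict.
    apply: le_trans (cmod_partial_sum_le n x intf) _.
    rewrite le_eqVlt; apply/orP; left; apply/eqP; apply: eq_integral => t _.
    by rewrite /K /= !mulrA.
apply: (@le_trans _ _ (M%:E * \int[mu]_(x in D) (S x `^ p * w x)%:E)%E).
  rewrite -ge0_integralZl//; last 3 first.
  - apply/measurable_EFinP; apply: measurable_funTS; apply: measurable_funM => //.
    exact: mpow.
  - by move=> t _; rewrite lee_fin mulr_ge0 ?powR_ge0 ?ltW ?poisson_gt0.
  - by rewrite lee_fin ltW.
  apply: ge0_le_integral => //.
  - by move=> t _; rewrite lee_fin powR_ge0.
  - by apply/measurable_EFinP; apply: measurable_funTS; exact: mpow.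
  - apply/measurable_EFinP; apply: measurable_funTS; apply: measurable_funM => //.
    by apply: measurable_funM => //; exact: mpow.
  - move=> x _; rewrite -EFinM lee_fin mulrCA ler_peMr ?powR_ge0//.
    by rewrite -ler_pdivrMl ?mulr1 ?poisson_ge.
have wM : (\int[mu]_(t in D) (cmod (f t) `^ p * w t)%:E <=
    M%:E * \int[mu]_(t in D) (cmod (f t) `^ p)%:E)%E.
  rewrite -ge0_integralZl//; last 3 first.
  - by apply/measurable_EFinP; apply: measurable_funTS; exact: mpow.
  - by move=> t _; rewrite lee_fin powR_ge0.
  - by rewrite lee_fin ltW.
  apply: ge0_le_integral => //.
  - by move=> t _; rewrite lee_fin mulr_ge0 ?powR_ge0 ?ltW ?poisson_gt0.
  - apply/measurable_EFinP; apply: measurable_funTS; apply: measurable_funM => //.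
    exact: mpow.
  - apply/measurable_EFinP; apply: measurable_funTS; apply: measurable_funM => //.
    exact: mpow.
  - by move=> t _; rewrite -EFinM lee_fin mulrC ler_wpM2r ?powR_ge0 ?poisson_le.
have -> : M ^+ 2 * L `^ p = M * (L `^ p * M) by ring.
rewrite (EFinM M) (EFinM (L `^ p)) -[leRHS]muleA.
rewrite lee_wpmul2l ?lee_fin ?(ltW M_gt0)// -muleA.
by apply: le_trans schur _; rewrite lee_wpmul2l ?lee_fin ?powR_ge0.
Qed.

End lp_bound.

Theorem theorem3 (R : realType) (a : R[i]) (ta : R) (theta : R -> R) (p : R)
  (f : R -> R[i]) (n : nat) :
  cmod a < 1 ->
  a = (cmod a)%:C * expi ta ->
  is_phase a theta ->
  1 <= p ->
  in_Lp p f ->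
  (LpNorm p (partial_sum (cmod a) ta theta n f) <=
   (((1 + cmod a) / (1 - cmod a)) `^ (2 / p) * lebesgue_const R n)%R%:E *
   LpNorm p f)%E.
Proof.
move=> a1 aE [_ phase] p1 [_ mf Nf]; have a0 := cmod_ge0 a.
have p0 : 0 < p by exact: lt_le_trans p1.
have twopi : 0 < (2 * pi)^-1 :> R by rewrite invr_gt0 mulr_gt0 ?pi_gt0.
have M0 : 0 <= (1 + cmod a) / (1 - cmod a).
  by rewrite divr_ge0 ?subr_ge0 ?(ltW a1)// addr_ge0.
have thetaE k t : expi (k%:~R * theta t) = expi (k%:~R * phase_branch (cmod a) ta t).
  by apply: expi_intr_congr; rewrite phase (expi_phase_branch a0 a1 t aE).
have -> : partial_sum (cmod a) ta theta n f =
    partial_sum (cmod a) ta (phase_branch (cmod a) ta) n f.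
  apply/funext => x; apply: eq_bigr => j _; rewrite /= thetaE; congr (_ * _).
  congr cmean; apply/funext => t; congr (_ * _ * _).
  by rewrite -!mulNr -mulrNz thetaE.
have intf := LpNorm_lty_cintegrable p1 mf Nf.
have mean_ge0 (g : R -> R[i]) : (0 <= ((2 * pi)^-1)%:E *
    \int[lebesgue_measure]_(x in `[(- pi)%R, pi]) (cmod (g x) `^ p)%:E)%E.
  rewrite mule_ge0 ?lee_fin ?(ltW twopi)// integral_ge0// => x _.
  by rewrite lee_fin powR_ge0.
have C0 : 0 <= ((1 + cmod a) / (1 - cmod a)) ^+ 2 * lebesgue_const R n `^ p.
  by rewrite mulr_ge0 ?exprn_ge0 ?powR_ge0.
rewrite /LpNorm.
have -> : ((1 + cmod a) / (1 - cmod a)) `^ (2 / p) * lebesgue_const R n =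
    (((1 + cmod a) / (1 - cmod a)) ^+ 2 * lebesgue_const R n `^ p) `^ p^-1.
  rewrite [RHS]powRM ?exprn_ge0 ?powR_ge0//.
  rewrite -[X in _ = _ * X]powRrM mulfV ?gt_eqF// powRr1 ?lebesgue_const_ge0//.
  by rewrite powRrM powR_mulrn.
rewrite -poweR_EFin -poweRM ?lee_fin ?mean_ge0//.
apply: gt0_ler_poweR; first by rewrite invr_ge0 ltW.
- by rewrite in_itv/= leey andbT mean_ge0.
- by rewrite in_itv/= leey andbT mule_ge0 ?lee_fin ?mean_ge0.
rewrite muleCA lee_wpmul2l ?lee_fin ?(ltW twopi)//.
exact: integral_partial_sum_le.
Qed.
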